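(* Let $\mathcal{A}$ be any deterministic ordinal stable algorithm. Then the distortion of $\mathcal{A}$ is unbounded, i.e., $\mathrm{dist}(\mathcal{A})=+\infty$.
   Context: Setting (stable matching): there are two disjoint sets of agents, men $M=\{m_1,\dots,m_n\}$ and women $W=\{w_1,\dots,w_n\}$. Every agent $a$ has a valuation function $v_a$ assigning a non-negative real value to each agent of the opposite side; $\mathbf{v}$ denotes the profile of all valuation functions (no normalization is imposed). A preference profile $\succ$ consists of a strict ranking $\succ_a$ of the opposite side for each agent $a$. It is consistent with (induced by) $\mathbf{v}$ if $b\succ_a b'$ implies $v_a(b)\ge v_a(b')$ (ties in values are broken arbitrarily to get strict rankings). A matching $\mu$ is a perfect one-to-one matching of $M$ and $W$; $\mu(a)$ is the partner of $a$. A pair $(m,w)$ is blocking for $\mu$ if $w\succ_m\mu(m)$ and $m\succ_w\mu(w)$. $\mu$ is stable if it has no blocking pair. $\mathcal{M}_s(\succ)$ is the set of stable matchings of $\succ$. The social welfare is $\mathrm{SW}(\mu\mid\mathbf{v})=\sum_{a\in M\cup W}v_a(\mu(a))$. A deterministic ordinal stable algorithm $\mathcal{A}$ is a function that, for every $n$, maps each preference profile $\succ$ (with $n$ men and $n$ women) to a stable matching $\mathcal{A}(\succ)\in\mathcal{M}_s(\succ)$; it does not see the values. Its distortion is $$\mathrm{dist}(\mathcal{A})=\sup_{n,\mathbf{v}}\frac{\max_{\mu\in\mathcal{M}_s(\succ_{\mathbf{v}})}\mathrm{SW}(\mu\mid\mathbf{v})}{\mathrm{SW}(\mathcal{A}(\succ_{\mathbf{v}})\mid\mathbf{v})},$$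 where the supremum is over all $n$, all valuation profiles $\mathbf{v}$ and preference profiles $\succ_{\mathbf{v}}$ consistent with $\mathbf{v}$, with the conventions $c/0=+\infty$ for $c>0$ and $0/0=1$. *)

(* Defs.v *)
From HB Require Import structures.
From mathcomp Require Import all_boot all_order all_algebra all_fingroup.
From mathcomp Require Import all_classical all_reals all_analysis.
Set Implicit Arguments.
Unset Strict Implicit.
Unset Printing Implicit Defensive.
Import Order.TTheory GRing.Theory Num.Theory.
Local Open Scope ring_scope.

(* Men and women are each indexed by ['I_n]; the two sides are kept apart by
   the separate fields of the records below. *)

(* A strict ranking of the opposite side: [r b] is the position of [b],
   position 0 being the most preferred. *)
Definition ranking (n : nat) := {perm 'I_n}.

Definition prefers (n : nat) (r : ranking n) (b b' : 'I_n) : bool :=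
  (r b < r b')%N.

Record preferences (n : nat) := Preferences {
  man_rank : {ffun 'I_n -> ranking n};
  woman_rank : {ffun 'I_n -> ranking n} }.

(* [mu m] is the wife of [m]; the husband of [w] is [(mu^-1)%g w]. *)
Definition matching (n : nat) := {perm 'I_n}.

Definition wife (n : nat) (mu : matching n) (m : 'I_n) : 'I_n := mu m.
Definition husband (n : nat) (mu : matching n) (w : 'I_n) : 'I_n :=
  (mu^-1)%g w.

Definition blocking (n : nat) (P : preferences n) (mu : matching n)
    (m w : 'I_n) : bool :=
  prefers (man_rank P m) w (wife mu m)
  && prefers (woman_rank P w) m (husband mu w).

Definition stable (n : nat) (P : preferences n) (mu : matching n) : bool :=
  [forall m, forall w, ~~ blocking P mu m w].

Record valuations (R : realType) (n : nat) := Valuations {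
  man_val : 'I_n -> 'I_n -> R;
  woman_val : 'I_n -> 'I_n -> R;
  man_val_ge0 : forall m w, 0 <= man_val m w;
  woman_val_ge0 : forall w m, 0 <= woman_val w m }.

Definition consistent (R : realType) (n : nat)
    (P : preferences n) (v : valuations R n) : Prop :=
  (forall m w w', prefers (man_rank P m) w w' ->
     man_val v m w' <= man_val v m w)
  /\ (forall w m m', prefers (woman_rank P w) m m' ->
     woman_val v w m' <= woman_val v w m).

Definition social_welfare (R : realType) (n : nat)
    (v : valuations R n) (mu : matching n) : R :=
  \sum_(m < n) man_val v m (wife mu m)
  + \sum_(w < n) woman_val v w (husband mu w).

(* Social welfare is nonnegative, so the default value 0 does not affect the
   maximum over the (nonempty) set of stable matchings. *)
Definition optimal_welfare (R : realType) (n : nat)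
    (P : preferences n) (v : valuations R n) : R :=
  \big[Num.max/0]_(mu : matching n | stable P mu) social_welfare v mu.

(* Quotient of nonnegative reals with c / 0 = +oo for c > 0 and 0 / 0 = 1. *)
Definition welfare_ratio (R : realType) (c d : R) : \bar R :=
  if d == 0 then (if c == 0 then 1%:E else +oo%E) else (c / d)%:E.

Definition ordinal_algorithm := forall n : nat, preferences n -> matching n.

Definition stable_algorithm (A : ordinal_algorithm) : Prop :=
  forall (n : nat) (P : preferences n), stable P (A n P).

Definition distortion (R : realType) (A : ordinal_algorithm) : \bar R :=
  ereal_sup [set x : \bar R |
    exists (n : nat) (v : valuations R n) (P : preferences n),
      consistent P v /\
      x = welfare_ratio (optimal_welfare P v) (social_welfare v (A n P))]%classic.

(* Main.v *)
(* Take two men and two women where man [i] prefers woman [i] while woman [i]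
   prefers the other man. Both perfect matchings are stable: one gives every man
   his favourite, the other every woman hers. Whichever one the algorithm
   returns, let the agents on the side it disfavours value their favourite at 1,
   and all other values be 0: the returned matching has welfare 0 and the other
   one welfare 2, so a single instance already has ratio [+oo]. *)
Require Import Defs.
From HB Require Import structures.
From mathcomp Require Import all_boot all_order all_algebra all_fingroup.
From mathcomp Require Import all_classical all_reals all_analysis.
Set Implicit Arguments.
Unset Strict Implicit.
Unset Printing Implicit Defensive.
Import Order.TTheory GRing.Theory Num.Theory.
Local Open Scope ring_scope.

(** The supremum bounds each ratio from above, so one instance of ratio [+oo] suffices. Here [mu]
    makes the optimum positive, and the convention for c / 0 applies. *)
Lemma distortion_pinfty (R : realType) (A : ordinal_algorithm) (n : nat)
    (v : valuations R n) (P : preferences n) (mu : matching n) :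
  consistent P v -> stable P mu -> 0 < social_welfare v mu ->
  social_welfare v (A n P) = 0 -> distortion R A = +oo%E.
Proof.
move=> cPv stmu mu_gt0 A0; apply/eqP; rewrite -leye_eq.
apply: ereal_sup_ubound; exists n, v, P; split=> //.
have opt_gt0 : 0 < optimal_welfare P v.
  apply: lt_le_trans mu_gt0 _.
  by rewrite /optimal_welfare (bigmaxD1 mu) // le_max lexx.
by rewrite /welfare_ratio A0 eqxx gt_eqF.
Qed.

Definition swap : {perm 'I_2} := tperm ord0 ord_max.

Lemma swapE (i j : 'I_2) : (swap i == j) = (i != j).
Proof.
rewrite /swap permE /=.
by move: i j => [[|[|//]] ?] [[|[|//]] ?].
Qed.

(** By injectivity the image of [ord0] determines [s]: the other point must go to the remaining
    value. *)
Lemma perm2P (s : {perm 'I_2}) : s = 1%g \/ s = swap.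
Proof.
have [s0|s0] := eqVneq (s ord0) ord0; [left|right]; apply/permP => i.
- rewrite perm1; have [->//|i0] := eqVneq i ord0.
  have : s i != ord0 by rewrite -[X in _ != X]s0 (inj_eq perm_inj).
  move: (s i) i0 => j; move: i j => [[|[|//]] ?] [[|[|//]] ?] //= _ _.
  exact: val_inj.
- apply/esym/eqP; rewrite swapE.
  have [->|i0] := eqVneq i ord0; first by rewrite eq_sym.
  have : s i != s ord0 by rewrite (inj_eq perm_inj).
  move: (s i) (s ord0) s0 i0 => j k.
  by move: i j k => [[|[|//]] ?] [[|[|//]] ?] [[|[|//]] ?].
Qed.

(** Rankings give positions: [1%g] puts index 0 first and [swap] puts index 1 first. *)
Definition opposed_preferences : preferences 2 :=
  Preferences [ffun m => if m == ord0 then 1%g else swap]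
              [ffun w => if w == ord0 then swap else 1%g].

Lemma prefers_man_opposed (m w w' : 'I_2) :
  prefers (man_rank opposed_preferences m) w w' = (w == m) && (w' != m).
Proof.
rewrite /prefers ffunE.
by move: m w w' => [[|[|//]] ?] [[|[|//]] ?] [[|[|//]] ?];
  rewrite /swap !permE.
Qed.

Lemma prefers_woman_opposed (w m m' : 'I_2) :
  prefers (woman_rank opposed_preferences w) m m' = (m != w) && (m' == w).
Proof.
rewrite /prefers ffunE.
by move: w m m' => [[|[|//]] ?] [[|[|//]] ?] [[|[|//]] ?];
  rewrite /swap !permE.
Qed.

(** In a blocking pair the man's gain would force [w == m] and the woman's gain [m != w]. *)
Lemma stable_opposed (mu : matching 2) : stable opposed_preferences mu.
Proof.
apply/forallP => m; apply/forallP => w.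
rewrite /blocking prefers_man_opposed prefers_woman_opposed eq_sym.
by case: (m == w); rewrite ?andbF.
Qed.

Section Valuations.
Variable R : realType.

Definition men_only : valuations R 2 :=
  @Valuations R 2 (fun m w => (m == w)%:R) (fun _ _ => 0)
    (fun _ _ => ler0n _ _) (fun _ _ => lexx 0).

Definition women_only : valuations R 2 :=
  @Valuations R 2 (fun _ _ => 0) (fun w m => (w != m)%:R)
    (fun _ _ => lexx 0) (fun _ _ => ler0n _ _).

Lemma consistent_men_only : consistent opposed_preferences men_only.
Proof.
(* The preferred woman is [m], who has the top value 1. *)
split=> //= m w w'; rewrite prefers_man_opposed => /andP[/eqP-> _].
by rewrite eqxx ler_nat leq_b1.
Qed.

Lemma consistent_women_only : consistent opposed_preferences women_only.
Proof.
split=> //= w m m'; rewrite prefers_woman_opposed => /andP[_ /eqP->].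
by rewrite eqxx ler0n.
Qed.

Lemma welfare_men_only (mu : matching 2) :
  social_welfare men_only mu = \sum_(m < 2) (m == mu m)%:R.
Proof. by rewrite /social_welfare /= [X in _ + X]big1_eq addr0. Qed.

Lemma welfare_women_only (mu : matching 2) :
  social_welfare women_only mu = \sum_(w < 2) (w != (mu^-1)%g w)%:R.
Proof. by rewrite /social_welfare /= [X in X + _]big1_eq add0r. Qed.

End Valuations.

Theorem theorem3p1 (R : realType) (A : ordinal_algorithm)
    (hA : stable_algorithm A) :
  distortion R A = +oo%E.
Proof.
have [A1|As] := perm2P (A 2 opposed_preferences).
(* The identity gives each woman her last choice, of value 0; [swap], its own inverse, gives each
   her favourite. *)
- apply: (distortion_pinfty (consistent_women_only R) (stable_opposed swap)).
    rewrite welfare_women_only tpermV !big_ord_recl big_ord0.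
    by rewrite ![_ == swap _]eq_sym !swapE !eqxx addr0 addr_gt0.
  by rewrite A1 welfare_women_only invg1 big1 // => w _; rewrite perm1 eqxx.
(* Now the men are the disfavoured side, and the identity serves them. *)
- apply: (distortion_pinfty (consistent_men_only R) (stable_opposed 1%g)).
    by rewrite welfare_men_only !big_ord_recl big_ord0 !perm1 !eqxx addr0 addr_gt0.
  by rewrite As welfare_men_only big1 // => m _; rewrite eq_sym swapE eqxx.
Qed.
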